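(* Let $f:[a,b]\to\mathbb{R}$ be a continuous $\Phi$-monotone function, where $\Phi$ is superadditive. Then for any $n\in\mathbb{N}$, $$f(a)-\frac{1}{2}\Phi(b-a)\leq\frac{1}{b-a}\mathcal{T}_{n}(f)\leq f(b)+\frac{1}{2}\Phi(b-a).$$
   Context: Let $a<b$ be real numbers. $\mathbb{N}$ denotes the set of positive integers and $\mathbb{R}_+$ the set of nonnegative reals. $\Phi:[0,b-a]\to\mathbb{R}_+$ is a function (called the error function); it is superadditive if $\Phi(x)+\Phi(y)\leq\Phi(x+y)$ whenever $x$, $y$ and $x+y$ belong to $[0,b-a]$. A function $f:[a,b]\to\mathbb{R}$ is $\Phi$-monotone if $f(x)\leq f(y)+\Phi(y-x)$ for all $x,y\in[a,b]$ with $x<y$. For $n\in\mathbb{N}$ put $x_i=a+\frac{(b-a)i}{n}$, $i=0,1,\ldots,n$. The Trapezoidal rule is $$\mathcal{T}_{n}(f)=\frac{b-a}{2n}\Big[f(x_0)+2\sum_{i=1}^{n-1}f(x_i)+f(x_n)\Big].$$ *)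

(* Defs.v *)
(* Functions on [a, b] and on
   [0, b - a] are total functions R -> R of which only the values on the
   interval are ever constrained or used. *)
From mathcomp Require Import all_boot all_order all_algebra.
From mathcomp Require Import all_classical all_reals all_analysis.

Set Implicit Arguments.
Unset Strict Implicit.
Unset Printing Implicit Defensive.

Import Order.TTheory GRing.Theory Num.Theory.
Import numFieldNormedType.Exports.

Local Open Scope classical_set_scope.
Local Open Scope ring_scope.

Definition error_function (R : realType) (a b : R) (Phi : R -> R) : Prop :=
  forall x, x \in `[0, b - a] -> 0 <= Phi x.

Definition superadditive (R : realType) (a b : R) (Phi : R -> R) : Prop :=
  forall x y, x \in `[0, b - a] -> y \in `[0, b - a] ->
    x + y \in `[0, b - a] -> Phi x + Phi y <= Phi (x + y).

Definition Phi_monotone (R : realType) (a b : R) (Phi f : R -> R) : Prop :=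
  forall x y, x \in `[a, b] -> y \in `[a, b] -> x < y ->
    f x <= f y + Phi (y - x).

Definition node (R : realType) (a b : R) (n i : nat) : R :=
  a + (b - a) * i%:R / n%:R.

Definition trapezoidal (R : realType) (a b : R) (n : nat) (f : R -> R) : R :=
  (b - a) / (2 * n%:R) *
  (f (node a b n 0) + 2 * \sum_(1 <= i < n) f (node a b n i)
   + f (node a b n n)).

(* Main.v *)
Require Import Defs.
From mathcomp Require Import all_boot all_order all_algebra.
From mathcomp Require Import all_classical all_reals all_analysis.
From mathcomp Require Import ring lra.
Set Implicit Arguments.
Unset Strict Implicit.
Unset Printing Implicit Defensive.
Import Order.TTheory GRing.Theory Num.Theory.
Import numFieldNormedType.Exports.
Local Open Scope classical_set_scope.
Local Open Scope ring_scope.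

(** The trapezoidal rule divided by [b - a] is a weighted mean of the values of
    [f] at the nodes [x_i], with weight [1 / n] at the interior nodes and
    [1 / (2n)] at the two endpoints. Phi-monotonicity compares each value with
    the value at an endpoint: [f a <= f x_i + Phi (x_i - a)] and
    [f x_i <= f b + Phi (b - x_i)]. It remains to bound the weighted mean of
    the errors by [Phi (b - a) / 2].

    The nodes are symmetric about the midpoint, so [x_i - a] and
    [x_(n-i) - a] add up to [b - a], and superadditivity bounds the sum of the
    errors at [x_i] and [x_(n-i)] by [Phi (b - a)]
    ([superadditive_node_left], [superadditive_node_right]). Pairing [i] with
    [n - i] ([sum_pairing_le]), the [n - 1] interior errors, counted twice,
    contribute at most [(n - 1) Phi (b - a)]. At one endpoint there is no error
    and at the other the error is [Phi (b - a)], whence a total of at most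
    [n Phi (b - a)], to be divided by [2n]. *)

(** Reversing the order of summation turns twice the sum into the sum of the
    paired terms. *)
Lemma sum_pairing_le (R : realType) (n : nat) (e : nat -> R) (C : R) :
    (forall i, (0 < i < n)%N -> e i + e (n - i)%N <= C) ->
  2 * \sum_(1 <= i < n) e i <= C *+ n.-1.
Proof.
move=> pair_le; rewrite mulr_natl mulr2n {2}big_nat_rev -big_split /=.
rewrite -subn1 -sumr_const_nat; apply: ler_sum_nat => i i_n.
by rewrite add1n subSS; exact: pair_le.
Qed.

Lemma node0 (R : realType) (a b : R) (n : nat) : node a b n 0 = a.
Proof. by rewrite /node mulr0 mul0r addr0. Qed.

Lemma nodenn (R : realType) (a b : R) (n : nat) :
  (0 < n)%N -> node a b n n = b.
Proof.
move=> n_gt0; rewrite /node mulfK ?pnatr_eq0 -?lt0n //.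
by rewrite addrC subrK.
Qed.

Lemma node_sym (R : realType) (a b : R) (n i : nat) :
  (0 < n)%N -> (i <= n)%N -> node a b n (n - i) - a = b - node a b n i.
Proof.
move=> n_gt0 le_in; rewrite /node natrB //.
have n_neq0 : n%:R != 0 :> R by rewrite pnatr_eq0 -lt0n.
by field.
Qed.

Lemma node_inner (R : realType) (a b : R) (n i : nat) :
  a < b -> (0 < i < n)%N -> a < node a b n i < b.
Proof.
move=> ab /andP[i_gt0 lt_in]; have n_gt0 := ltn_trans i_gt0 lt_in.
have a_lt j : (0 < j)%N -> a < node a b n j.
  move=> j_gt0; rewrite /node ltrDl divr_gt0 ?ltr0n // mulr_gt0 ?ltr0n //.
  by rewrite subr_gt0.
rewrite a_lt // -subr_gt0 -node_sym // ?subr_gt0; last exact: ltnW.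
by rewrite a_lt // subn_gt0.
Qed.

Lemma superadditive_node_left (R : realType) (a b : R) (Phi : R -> R)
    (n i : nat) :
    a < b -> superadditive a b Phi -> (0 < i < n)%N ->
  Phi (node a b n i - a) + Phi (node a b n (n - i) - a) <= Phi (b - a).
Proof.
move=> ab Phi_sup i_n; have /andP[a_lt lt_b] := node_inner ab i_n.
move: i_n => /andP[i_gt0 lt_in].
rewrite node_sym ?(ltnW lt_in) //; last exact: ltn_trans lt_in.
have -> : b - a = (node a b n i - a) + (b - node a b n i) by ring.
by apply: Phi_sup; rewrite in_itv /=; apply/andP; split; lra.
Qed.

(** The distances of the interior nodes to [b] are their distances to [a], in
    reverse order. *)
Lemma superadditive_node_right (R : realType) (a b : R) (Phi : R -> R)
    (n i : nat) :
    a < b -> superadditive a b Phi -> (0 < i < n)%N ->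
  Phi (b - node a b n i) + Phi (b - node a b n (n - i)) <= Phi (b - a).
Proof.
move=> ab Phi_sup i_n; have /andP[i_gt0 lt_in] := i_n.
have n_gt0 := ltn_trans i_gt0 lt_in; have le_in := ltnW lt_in.
rewrite -!node_sym ?leq_subr // subKn // addrC.
exact: superadditive_node_left.
Qed.

Lemma trapezoidal_mean (R : realType) (a b : R) (n : nat) (f : R -> R) :
    a < b -> (0 < n)%N ->
  1 / (b - a) * trapezoidal a b n f =
    (f a + 2 * \sum_(1 <= i < n) f (node a b n i) + f b) / (2 * n%:R).
Proof.
move=> ab n_gt0; rewrite /trapezoidal node0 nodenn //.
have ba_neq0 : b - a != 0 by rewrite subr_eq0 gt_eqF.
have n_neq0 : n%:R != 0 :> R by rewrite pnatr_eq0 -lt0n.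
by field; rewrite n_neq0.
Qed.

Theorem corollary2 (R : realType) (a b : R) (Phi f : R -> R)
    (hab : a < b)
    (hPhi : error_function a b Phi)
    (hsup : superadditive a b Phi)
    (hcont : {within `[a, b], continuous f})
    (hmono : Phi_monotone a b Phi f) :
  forall n : nat, (0 < n)%N ->
    f a - 1 / 2 * Phi (b - a) <= 1 / (b - a) * trapezoidal a b n f /\
    1 / (b - a) * trapezoidal a b n f <= f b + 1 / 2 * Phi (b - a).
Proof.
move=> n n_gt0; rewrite trapezoidal_mean //.
have itv_a : a \in `[a, b] by rewrite in_itv /= lexx ltW.
have itv_b : b \in `[a, b] by rewrite in_itv /= lexx ltW.
have itv_node i : (0 < i < n)%N -> node a b n i \in `[a, b].
  by move=> /(node_inner hab)/andP[? ?]; rewrite in_itv /= !ltW.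
have f_ab := hmono a b itv_a itv_b hab.
have n2_gt0 : 0 < 2 * n%:R :> R by rewrite mulr_gt0 ?ltr0n.
have natn : n%:R = n.-1%:R + 1 :> R by rewrite natr1 prednK.
split.
- have f_ge : f a *+ n.-1 <= \sum_(1 <= i < n) f (node a b n i)
                            + \sum_(1 <= i < n) Phi (node a b n i - a).
    rewrite -big_split /= -subn1 -sumr_const_nat.
    apply: ler_sum_nat => i i_n; have /andP[lt_a _] := node_inner hab i_n.
    exact: hmono (itv_node _ i_n) lt_a.
  have := sum_pairing_le (fun i => @superadditive_node_left _ a b Phi n i hab hsup).
  rewrite ler_pdivlMr // natn; move: f_ge.
  by rewrite -(mulr_natr (f a)) -(mulr_natr (Phi _)); lra.
- have f_le : \sum_(1 <= i < n) f (node a b n i)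
              <= f b *+ n.-1 + \sum_(1 <= i < n) Phi (b - node a b n i).
    rewrite -subn1 -sumr_const_nat -big_split /=.
    apply: ler_sum_nat => i i_n; have /andP[_ lt_b] := node_inner hab i_n.
    exact: hmono (itv_node _ i_n) itv_b lt_b.
  have := sum_pairing_le (fun i => @superadditive_node_right _ a b Phi n i hab hsup).
  rewrite ler_pdivrMr // natn; move: f_le.
  by rewrite -(mulr_natr (f b)) -(mulr_natr (Phi _)); lra.
Qed.
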